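(* Let $(\Omega_1,\mu_1)$ and $(\Omega_2,\mu_2)$ be measure spaces. Then $$L(\infty,\infty)(\Omega_1)\otimes L^\infty(\Omega_2)\subset L(\infty,\infty)(\Omega_1\times\Omega_2),$$ that is, for every $f\in L(\infty,\infty)(\Omega_1)$ and $g\in L^\infty(\Omega_2)$ one has $f\otimes g\in L(\infty,\infty)(\Omega_1\times\Omega_2)$, with $$\|f\otimes g\|_{L(\infty,\infty)(\Omega_1\times\Omega_2)}\le\|f\|_{L(\infty,\infty)(\Omega_1)}\,\|g\|_{L^\infty(\Omega_2)}.$$
   Context: $(f\otimes g)(x,y)=f(x)g(y)$ on $\Omega_1\times\Omega_2$, which carries the product measure $\mu_1\times\mu_2$ (a measure on the product $\sigma$-algebra with $(\mu_1\times\mu_2)(A\times B)=\mu_1(A)\mu_2(B)$ for measurable $A,B$, where $0\cdot\infty=0$). Functions are measurable, scalar-valued, finite a.e. For a function $h$ on a measure space $(\Omega,\mu)$: $\lambda_h(s)=\mu(\{|h|>s\})\in[0,\infty]$, $s\ge 0$; $h^*(t)=\inf\{s\ge0:\lambda_h(s)\le t\}$ for $t>0$ (with $\inf\emptyset=\infty$); $h^{**}(t)=\frac1t\int_0^th^*(s)\,ds$. Let $\|h\|_{L(\infty,\infty)(\Omega)}=\sup_{t>0}\{h^{**}(t)-h^*(t)\}$, and let $L(\infty,\infty)(\Omega)$ be the set of $h$ for which this is finite. The difference is interpreted through the identity $t(h^{**}(t)-h^*(t))=\int_{h^*(t)}^\infty\lambda_h(s)\,ds$; in particular it is $0$ when $h^*(t)=\infty$.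 *)

(* Defs.v *)
From HB Require Import structures.
From mathcomp Require Import all_boot all_order all_algebra.
From mathcomp Require Import all_classical all_reals all_analysis.
From mathcomp Require Import measurable_realfun complex.

Set Implicit Arguments.
Unset Strict Implicit.
Unset Printing Implicit Defensive.

Import Order.TTheory GRing.Theory Num.Theory.
Import numFieldNormedType.Exports.

Local Open Scope classical_set_scope.
Local Open Scope ring_scope.
Local Open Scope ereal_scope.

Section rearrangement.
Context d (T : measurableType d) (R : realType).
Variable mu : {measure set T -> \bar R}.
Implicit Types (h : T -> \bar R) (s t : R).

Definition distribution_fun h s : \bar R := mu [set x | s%:E < `|h x|].

(* The infimum is taken in [\bar R], so it is [+oo] on the empty set. *)
Definition rearr h t : \bar R :=
  ereal_inf [set s%:E | s in [set s | (0 <= s)%R /\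
                                      distribution_fun h s <= t%:E]].

Definition max_rearr h t : \bar R :=
  (t^-1)%:E * \int[@lebesgue_measure R]_(s in `]0%R, t[) rearr h s.

(* When [rearr h t] is finite the difference is well defined in [0, +oo] and
   equals (1/t) \int_(rearr h t)^oo distribution_fun h.  When [rearr h t = +oo]
   that integral is 0, whereas [+oo - +oo] is [-oo] in [\bar R]; hence the case
   distinction. *)
Definition rearr_gap h t : \bar R :=
  if rearr h t == +oo then 0 else max_rearr h t - rearr h t.

Definition Linfinf_norm h : \bar R :=
  ereal_sup [set rearr_gap h t | t in [set t | (0 < t)%R]].

Definition in_Linfinf h : Prop :=
  [/\ measurable_fun [set: T] h,
      {ae mu, forall x, h x \is a fin_num} &
      Linfinf_norm h < +oo].

Definition in_Linf h : Prop :=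
  measurable_fun [set: T] h /\ 'N[mu]_+oo[h] < +oo.

End rearrangement.

(* Complex scalars: the norms depend on a function only through its modulus,
   and Borel measurability is that of the real and imaginary parts. *)
Section complex_valued.
Context d (T : measurableType d) (R : realType).
Variable mu : {measure set T -> \bar R}.
Implicit Types h : T -> R[i].

Definition cmodulus h : T -> \bar R := fun x => (Normc.normc (h x))%:E.

Definition cmeasurable h : Prop :=
  measurable_fun [set: T] (fun x => complex.Re (h x)) /\
  measurable_fun [set: T] (fun x => complex.Im (h x)).

Definition in_cLinfinf h : Prop :=
  cmeasurable h /\ Linfinf_norm mu (cmodulus h) < +oo.

Definition in_cLinf h : Prop :=
  cmeasurable h /\ 'N[mu]_+oo[cmodulus h] < +oo.

End complex_valued.

(* No sigma-finiteness is assumed, so a product measure need not be unique;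
   [0 * +oo = 0] in [\bar R]. *)
Definition is_product_measure d1 d2 (T1 : measurableType d1)
    (T2 : measurableType d2) (R : realType)
    (mu1 : {measure set T1 -> \bar R}) (mu2 : {measure set T2 -> \bar R})
    (mu : {measure set (T1 * T2) -> \bar R}) : Prop :=
  forall (A : set T1) (B : set T2), measurable A -> measurable B ->
    mu (A `*` B) = mu1 A * mu2 B.

Definition etensor (T1 T2 : Type) (R : realType)
    (f : T1 -> \bar R) (g : T2 -> \bar R) : T1 * T2 -> \bar R :=
  fun z => f z.1 * g z.2.

Definition ctensor (T1 T2 : Type) (R : realType)
    (f : T1 -> R[i]) (g : T2 -> R[i]) : T1 * T2 -> R[i] :=
  fun z => (f z.1 * g z.2)%R.

(* Main.v *)
Require Import Defs.
From mathcomp Require Import all_boot all_order all_algebra.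
From mathcomp Require Import all_classical all_reals all_analysis.
From mathcomp Require Import measurable_realfun complex ess_sup_inf.

(** The estimate is proved through a condition on distribution functions alone.
    Write [D_h] for [distribution_fun mu h].  By the layer-cake formula
    ([integral_rearr], [rearr_gapE]), when [t > 0] and [z = rearr h t] is finite,
    [t * rearr_gap h t] is the integral of [D_h] over [(z, +oo)].  It follows
    that, for a real [C >= 0], [Linfinf_norm h <= C] is equivalent to
    [tail_bound h C]: for every [z >= 0] with [D_h z] finite, the integral of
    [D_h] over [(z, +oo)] is at most [C * D_h z]
    ([Linfinf_norm_le_tail_bound], [tail_bound_Linfinf_norm_le]).

    Let [C] be the norm of [f] and [G] the essential supremum of [|g|].  The
    norm is homogeneous ([Linfinf_normZ]), so [c f] satisfies the tail bound with constant
    [C * G] whenever [0 <= c <= G].  If [psi] is a nonnegative simple function,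
    the set [{s < |f| psi}] is the disjoint union of the finitely many
    measurable rectangles [{s < |c f|} x {psi = c}], so
    [D_(f (x) psi) s] is the sum of the [D_(c f) s * mu2 {psi = c}]
    ([distribution_fun_etensor_nnsfun]), and the tail bounds of the [c f] add
    up to one for [f (x) psi] ([tail_bound_etensor_nnsfun]).  Finally, simple
    functions increasing to [|g|] make the distribution functions increase to
    that of [f (x) g], and monotone convergence preserves the tail bound
    ([tail_bound_etensor]).

    The product measure enters only through its values on measurable rectangles,
    finite additivity and continuity from below, and Tonelli's theorem is only
    used for the Lebesgue measure on the line; this is why no sigma-finiteness
    of [mu1] and [mu2] is needed.  The complex case reduces to the extended-real one because the
    modulus is multiplicative. *)

Set Implicit Arguments.
Unset Strict Implicit.
Unset Printing Implicit Defensive.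

Import Order.TTheory GRing.Theory Num.Theory.
Import numFieldNormedType.Exports.

Local Open Scope classical_set_scope.
Local Open Scope ring_scope.
Local Open Scope ereal_scope.

(** * The decreasing rearrangement and the layer-cake formula *)

Section distribution_function.
Context {d} {T : measurableType d} {R : realType}.
Variable mu : {measure set T -> \bar R}.
Implicit Types (h : T -> \bar R) (r s t z : R).

Lemma measurable_abse_gt h s : measurable_fun [set: T] h ->
  measurable [set x | s%:E < `|h x|].
Proof.
move=> mh; rewrite -[X in measurable X]setTI.
by apply: emeasurable_fun_o_infty => //; exact: measurableT_comp.
Qed.

Lemma distribution_fun_ge0 h s : 0 <= distribution_fun mu h s.
Proof. exact: measure_ge0. Qed.

Lemma distribution_fun_nincr h : measurable_fun [set: T] h ->
  {homo distribution_fun mu h : r s / (r <= s)%R >-> s <= r}.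
Proof.
move=> mh r s rs; apply: le_measure; rewrite ?inE; [exact: measurable_abse_gt..|].
by move=> x /=; apply: le_lt_trans; rewrite lee_fin.
Qed.

Lemma measurable_distribution_fun h (D : set R) : measurable_fun [set: T] h ->
  measurable_fun D (distribution_fun mu h).
Proof.
move=> mh; apply: measurable_funTS => mD.
apply: (measurability _ (ErealGenOInfty.measurableE R)) => //.
move=> _ [_ [y ->] <-]; rewrite setTI.
apply: is_interval_measurable => s t/=.
rewrite !in_itv/= !andbT => fs ft u /andP[su ut].
by rewrite in_itv/= andbT; apply: lt_le_trans ft _; exact: distribution_fun_nincr.
Qed.

Lemma rearr_ge0 h t : 0 <= rearr mu h t.
Proof. by apply/ereal_infP => _ [s [s0 _] <-]; rewrite lee_fin. Qed.

(** The rearrangement is the generalized inverse of the distribution function.  The implication from right to left is where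
    continuity from below of the measure enters. *)
Lemma rearr_gtE h r s : measurable_fun [set: T] h -> (0 <= r)%R ->
  (r%:E < rearr mu h s) = (s%:E < distribution_fun mu h r).
Proof.
move=> mh r0; apply/idP/idP; apply: contraTT; rewrite -!leNgt => H.
  by apply: ereal_inf_lbound; exists r.
rewrite leNgt; apply/negP => sr; move: H; apply/negP; rewrite -ltNge.
pose F n := [set x | (r + n.+1%:R^-1)%:E < `|h x|].
have Fr : \bigcup_n F n = [set x | r%:E < `|h x|].
  apply/seteqP; split => x /=.
    by move=> [n _]; apply: lt_trans; rewrite lte_fin ltrDl.
  rewrite /F; case hx: (`|h x|) => [y| |] //.
    rewrite lte_fin => /ltr_add_invr[n rn]; exists n => //=.
    by rewrite hx lte_fin.
  by move=> _; exists 0%N => //=; rewrite hx ltry.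
have mF n : measurable (F n) by exact: measurable_abse_gt.
have ndF : nondecreasing_seq F.
  move=> m n mn; apply/subsetPset => x /=; apply: le_lt_trans.
  by rewrite lee_fin lerD2l lef_pV2 ?posrE// ler_nat.
have := @nondecreasing_cvg_mu _ _ _ mu _ mF (bigcupT_measurable _ mF) ndF.
have ndm : nondecreasing_seq (mu \o F).
  move=> m n mn /=; apply: le_measure; rewrite ?inE//.
  exact/subsetPset/ndF.
move=> /cvg_lim; rewrite (cvg_lim _ (ereal_nondecreasing_cvgn ndm))//.
move=> /(_ (@ereal_hausdorff R)).
rewrite Fr => FE; move: sr; rewrite /distribution_fun -FE.
move=> /ereal_sup_gt[_ [n _ <-] /= sn].
apply: (@lt_le_trans _ _ (r + n.+1%:R^-1)%:E); first by rewrite lte_fin ltrDl.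
apply/ereal_infP => _ [u [u0 us] <-]; rewrite lee_fin leNgt; apply/negP => un.
move: sn; apply/negP; rewrite -leNgt; apply: le_trans us.
by apply: distribution_fun_nincr => //; exact: ltW.
Qed.

Lemma measurable_rearr h : measurable_fun [set: T] h ->
  measurable_fun [set: R] (rearr mu h).
Proof.
move=> mh; apply: (measurability _ (ErealGenOInfty.measurableE R)) => //.
move=> _ [_ [y ->] <-]; rewrite setTI.
apply: is_interval_measurable => s t/=.
rewrite !in_itv/= !andbT => fs ft u /andP[su ut].
rewrite in_itv/= andbT; apply: lt_le_trans ft _.
apply: ereal_inf_le_tmp => _ [v [v0 vu] <-].
by exists v => //; split => //; apply: le_trans vu _; rewrite lee_fin.
Qed.

(** Layer cake: both sides are the area of
    [{(s, r) | 0 < s < t, z < r, s < distribution_fun mu h r}]. *)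
Lemma integral_rearr h t z : measurable_fun [set: T] h -> (0 < t)%R ->
  rearr mu h t = z%:E ->
  \int[@lebesgue_measure R]_(s in `]0%R, t[) rearr mu h s =
  (t * z)%:E +
  \int[@lebesgue_measure R]_(r in `]z, +oo[) distribution_fun mu h r.
Proof.
move=> mh t0 tz.
have z0 : (0 <= z)%R by rewrite -lee_fin -tz rearr_ge0.
have lez s : (s < t)%R -> z%:E <= rearr mu h s.
  move=> st; rewrite -tz; apply: ereal_inf_le_tmp => _ [v [v0 vu] <-].
  by exists v => //; split => //; apply: le_trans vu _; rewrite lee_fin ltW.
have lzt : distribution_fun mu h z <= t%:E.
  by rewrite leNgt -rearr_gtE// tz ltxx.
pose A := [set p : R * R | [/\ p.1 \in `]0%R, t[, p.2 \in `]z, +oo[ &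
  p.1%:E < distribution_fun mu h p.2]].
have mA : measurable A.
  rewrite (_ : A = (`]0%R, t[ `*` `]z, +oo[) `&`
     ([set: R * R] `&` [set p | p.1%:E < distribution_fun mu h p.2])); last first.
    by rewrite setTI; apply/seteqP; split => -[x y]/=; [case=> ? ? ?|case=> -[? ?] ?].
  apply: measurableI; first exact: measurableX.
  apply: measurable_lte => //; first exact: measurableT_comp.
  apply: (@measurableT_comp _ _ _ _ _ _ (distribution_fun mu h)).
    exact: measurable_distribution_fun.
  exact: measurable_snd.
(* The section at [s] is the interval from [z] to [rearr mu h s]. *)
have xA s : s \in `]0%R, t[ ->
    lebesgue_measure (xsection A s) = rearr mu h s - z%:E.
  move=> st; have s0t := st; rewrite in_itv/= in s0t; case/andP: s0t => s0 s_lt_t.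
  have -> : xsection A s = [set r | z%:E < r%:E < rearr mu h s].
    apply/seteqP; split => r;
      rewrite /xsection/= ?in_setE /A /= !in_itv/= andbT lte_fin.
      by move=> [_ zr sr]; rewrite zr rearr_gtE// (le_trans z0 (ltW zr)).
    by move=> /andP[zr]; rewrite rearr_gtE ?(le_trans z0 (ltW zr))// s0 s_lt_t.
  move: (lez s s_lt_t); case: (rearr mu h s) => [w| |]//; last first.
    move=> _; rewrite (_ : [set _ | _] = `]z, +oo[%classic).
      by rewrite lebesgue_measure_itv/= ltry.
    by apply/seteqP; split => r/=; rewrite in_itv/= ltry lte_fin.
  rewrite lee_fin => zw; rewrite (_ : [set _ | _] = `]z, w[%classic).
    rewrite lebesgue_measure_itv/= lte_fin; case: ltgtP zw => // -> _.
    by rewrite subee.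
  by apply/seteqP; split => r/=; rewrite in_itv/= !lte_fin.
(* The section at [r] is the interval from [0] to [distribution_fun mu h r]: the
   condition [s < t] is void, as [distribution_fun mu h r <= t] for [r > z]. *)
have yA r : r \in `]z, +oo[ ->
    lebesgue_measure (ysection A r) = distribution_fun mu h r.
  move=> zr'; have zr : (z < r)%R by rewrite in_itv/= andbT in zr'.
  have rt : distribution_fun mu h r <= t%:E.
    by apply: le_trans lzt; apply: distribution_fun_nincr => //; exact: ltW.
  have rfin : distribution_fun mu h r \is a fin_num.
    by rewrite ge0_fin_numE ?distribution_fun_ge0// (le_lt_trans rt) ?ltry.
  have [w rw] : exists w, distribution_fun mu h r = w%:E.
    by exists (fine (distribution_fun mu h r)); rewrite fineK.
  move: rt (distribution_fun_ge0 h r); rewrite rw.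
  rewrite !lee_fin => wt w0; rewrite (_ : ysection A r = `]0%R, w[%classic).
    rewrite lebesgue_measure_itv/= lte_fin; case: ltgtP w0 => // [|<-//].
    by rewrite oppr0 adde0.
  apply/seteqP; split => s;
    rewrite /ysection/= ?in_setE /A /= !in_itv/= andbT rw lte_fin.
    by move=> [/andP[-> _] _ ->].
  by move=> /andP[s0 sw]; rewrite s0 zr sw (lt_le_trans sw wt).
have := @indic_fubini_tonelli _ _ _ _ R lebesgue_measure lebesgue_measure A mA.
rewrite indic_fubini_tonelli_FE// indic_fubini_tonelli_GE//=.
rewrite (_ : (fun _ => lebesgue_measure (xsection A _)) =
   (fun s => rearr mu h s - z%:E) \_ `]0%R, t[); last first.
  apply/funext => s; rewrite patchE mem_setE; case: ifPn => [/xA//|st].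
  rewrite (_ : xsection A s = set0) ?measure0//.
  apply/seteqP; split => r //; rewrite /xsection/= inE /A/= => -[st'].
  by rewrite st' in st.
rewrite (_ : (fun _ => lebesgue_measure (ysection A _)) =
   (distribution_fun mu h) \_ `]z, +oo[); last first.
  apply/funext => r; rewrite patchE mem_setE; case: ifPn => [/yA//|zr].
  rewrite (_ : ysection A r = set0) ?measure0//.
  apply/seteqP; split => s //; rewrite /ysection/= inE /A/= => -[_ zr'].
  by rewrite zr' in zr.
rewrite -!integral_mkcond => <-.
have -> : (t * z)%:E = \int[@lebesgue_measure R]_(s in `]0%R, t[) (cst z%:E) s.
  rewrite integral_cst//= lebesgue_measure_itv/= lte_fin t0 oppr0 adde0.
  by rewrite -EFinM mulrC.
rewrite -ge0_integralD//=.
- by apply: eq_integral => s _; rewrite addeCA -EFinD subrr adde0.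
- by move=> s; rewrite in_itv/= => /andP[_ st]; rewrite EFinN sube_ge0// lez.
- by apply: emeasurable_funD => //; apply: measurable_funTS; exact: measurable_rearr.
Qed.

End distribution_function.

(** * The gap norm as a tail bound *)

Section tail_bound.
Context {d} {T : measurableType d} {R : realType}.
Variable mu : {measure set T -> \bar R}.
Implicit Types (h : T -> \bar R) (r s t z c C : R).

(** The reformulation of [Linfinf_norm mu h <= C] in terms of the distribution
    function.  Nothing is required at the points [z] where the distribution
    function is infinite, in accordance with [rearr_gap] being [0] when the
    rearrangement is infinite. *)
Definition tail_bound h C := forall z, (0 <= z)%R ->
  distribution_fun mu h z < +oo ->
  \int[@lebesgue_measure R]_(r in `]z, +oo[) distribution_fun mu h r <=
  C%:E * distribution_fun mu h z.

Lemma rearr_gapE h t z : measurable_fun [set: T] h -> (0 < t)%R ->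
  rearr mu h t = z%:E ->
  rearr_gap mu h t = (t^-1)%:E *
    \int[@lebesgue_measure R]_(r in `]z, +oo[) distribution_fun mu h r.
Proof.
move=> mh t0 tz; rewrite /rearr_gap tz/= /max_rearr (integral_rearr _ _ tz)//.
have z0 : (0 <= z)%R by rewrite -lee_fin -tz rearr_ge0.
have I0 : 0 <= \int[@lebesgue_measure R]_(r in `]z, +oo[) distribution_fun mu h r.
  by apply: integral_ge0 => *; exact: distribution_fun_ge0.
rewrite ge0_muleDr ?lee_fin ?mulr_ge0// ?(ltW t0)//.
by rewrite -EFinM mulKf ?gt_eqF// addeAC subee// add0e.
Qed.

Lemma rearr_gap_ge0 h t : measurable_fun [set: T] h -> (0 < t)%R ->
  0 <= rearr_gap mu h t.
Proof.
move=> mh t0; have := rearr_ge0 mu h t; case tz : (rearr mu h t) => [z| |]// _.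
  rewrite (rearr_gapE mh t0 tz) mule_ge0 ?lee_fin ?invr_ge0 ?(ltW t0)//.
  by apply: integral_ge0 => *; exact: distribution_fun_ge0.
by rewrite /rearr_gap tz eqxx.
Qed.

Lemma Linfinf_norm_ge0 h : measurable_fun [set: T] h -> 0 <= Linfinf_norm mu h.
Proof.
move=> mh; apply: (@le_trans _ _ (rearr_gap mu h 1)).
  exact: rearr_gap_ge0.
by apply: ereal_sup_ubound; exists 1%R => //=.
Qed.

(** For a given [z], the norm is tested at [t = distribution_fun mu h z]: then
    [rearr mu h t <= z], so that the integral over [(z, +oo)] is part of
    [t * rearr_gap mu h t]. *)
Lemma Linfinf_norm_le_tail_bound h C : measurable_fun [set: T] h ->
  Linfinf_norm mu h <= C%:E -> tail_bound h C.
Proof.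
move=> mh hC z z0 lz.
have I0 y : 0 <= \int[@lebesgue_measure R]_(r in `]y, +oo[) distribution_fun mu h r.
  by apply: integral_ge0 => *; exact: distribution_fun_ge0.
have [t tE] : exists t, distribution_fun mu h z = t%:E.
  exists (fine (distribution_fun mu h z)).
  by rewrite fineK// ge0_fin_numE ?distribution_fun_ge0.
have : 0 <= t%:E by rewrite -tE distribution_fun_ge0.
(* The norm only tests positive [t]; if [t = 0] the distribution function
   vanishes on [z, +oo). *)
rewrite lee_fin le_eqVlt => /predU1P[t0|t0].
  rewrite tE -t0 mule0 (eq_integral (cst 0)) ?integral0// => r.
  rewrite inE/= in_itv/= andbT => zr; apply/eqP; rewrite eq_le distribution_fun_ge0.
  rewrite andbT [leRHS](_ : 0 = distribution_fun mu h z); last by rewrite tE -t0.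
  by apply: distribution_fun_nincr => //; exact: ltW.
have lez : rearr mu h t <= z%:E.
  by apply: ereal_inf_lbound; exists z => //; split => //; rewrite tE.
have [w wE] : exists w, rearr mu h t = w%:E.
  exists (fine (rearr mu h t)).
  by rewrite fineK// ge0_fin_numE ?rearr_ge0// (le_lt_trans lez) ?ltry.
have : rearr_gap mu h t <= C%:E.
  by apply: le_trans hC; apply: ereal_sup_ubound; exists t.
rewrite (rearr_gapE mh t0 wE) tE muleC lee_pdivrMr// => /(le_trans _); apply.
apply: ge0_subset_integral => //=.
- exact: measurable_distribution_fun.
- by apply: subset_itvr; rewrite bnd_simp -lee_fin -wE.
Qed.

(** Conversely, for a given [t] the bound is applied at [z = rearr mu h t], where
    the distribution function is at most [t]. *)
Lemma tail_bound_Linfinf_norm_le h C : measurable_fun [set: T] h ->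
  (0 <= C)%R -> tail_bound h C -> Linfinf_norm mu h <= C%:E.
Proof.
move=> mh C0 hC; apply/ereal_supP => _ [t /= t0 <-].
have := rearr_ge0 mu h t; case tz : (rearr mu h t) => [z| |]//; last first.
  by rewrite /rearr_gap tz eqxx lee_fin.
rewrite lee_fin => z0; rewrite (rearr_gapE mh t0 tz) muleC lee_pdivrMr//.
have lzt : distribution_fun mu h z <= t%:E.
  by rewrite leNgt -rearr_gtE// tz ltxx.
apply: le_trans (hC z z0 (le_lt_trans lzt (ltry _))) _.
by rewrite lee_wpmul2l.
Qed.

Lemma rearrZ h c t : (0 < c)%R ->
  rearr mu (fun x => c%:E * h x) t = c%:E * rearr mu h t.
Proof.
move=> c0; rewrite -ereal_inf_pZl//; congr ereal_inf.
have distZ s : distribution_fun mu (fun x => c%:E * h x) (c * s) =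
    distribution_fun mu h s.
  congr (mu _); apply/seteqP; split => x /=;
  by rewrite abseM/= gtr0_norm// EFinM lte_pmul2l.
apply/seteqP; split => [_ [s [s0 st] <-]|_ [_ [s [s0 st] <-] <-]].
  exists (s / c)%:E; last by rewrite -EFinM mulrC divfK ?gt_eqF.
  exists (s / c)%R => //; split; first by rewrite divr_ge0// ltW.
  by rewrite -distZ mulrC divfK ?gt_eqF.
exists (c * s)%R; last by rewrite EFinM.
by split; [rewrite mulr_ge0// ltW|rewrite distZ].
Qed.

Lemma Linfinf_normZ h c C : measurable_fun [set: T] h -> (0 <= c)%R ->
  Linfinf_norm mu h <= C%:E ->
  Linfinf_norm mu (fun x => c%:E * h x) <= (c * C)%:E.
Proof.
move=> mh; rewrite le_eqVlt => /predU1P[<-|c0] hC.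
  rewrite mul0r; apply: tail_bound_Linfinf_norm_le => //.
    exact: measurable_funeM.
  move=> z z0 _; rewrite mul0e (eq_integral (cst 0)) ?integral0// => r.
  rewrite inE/= in_itv/= andbT => zr; rewrite /distribution_fun.
  rewrite [X in mu X](_ : _ = set0) ?measure0//.
  apply/seteqP; split => x //=; rewrite mul0e abse0 lte_fin => /(lt_trans zr).
  by rewrite ltNge z0.
apply/ereal_supP => _ [t /= t0 <-].
have ht : rearr_gap mu h t <= C%:E.
  by apply: le_trans hC; apply: ereal_sup_ubound; exists t.
rewrite EFinM; apply: le_trans (lee_wpmul2l _ ht); last by rewrite lee_fin ltW.
have := rearr_ge0 mu h t; rewrite /rearr_gap rearrZ//.
case tz : (rearr mu h t) => [z| |]// _; last by rewrite gt0_muley ?lte_fin// eqxx mule0.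
rewrite -!EFinM [X in X <= _]/= [X in _ <= _ * X]/=.
rewrite [leRHS]muleDr ?fin_num_adde_defl//.
have -> : (- (c * z))%:E = c%:E * (- z)%:E by rewrite -EFinM mulrN.
rewrite leeD2r// /max_rearr.
under eq_integral do rewrite rearrZ//.
rewrite ge0_integralZl//=.
- by rewrite muleCA.
- by apply: measurable_funTS; exact: measurable_rearr.
- by move=> *; exact: rearr_ge0.
- by rewrite lee_fin ltW.
Qed.

End tail_bound.

(** * Tensor products of extended-real functions *)

Section tensor.
Context {d1 d2} {T1 : measurableType d1} {T2 : measurableType d2}.
Context {R : realType}.
Variables (mu1 : {measure set T1 -> \bar R}) (mu2 : {measure set T2 -> \bar R}).
Variable mu : {measure set (T1 * T2) -> \bar R}.
Hypothesis mu12 : is_product_measure mu1 mu2 mu.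
Implicit Types (f : T1 -> \bar R) (g : T2 -> \bar R).

Lemma measurable_etensor f g : measurable_fun [set: T1] f ->
  measurable_fun [set: T2] g -> measurable_fun [set: T1 * T2] (etensor f g).
Proof.
by move=> mf mg; apply: emeasurable_funM; apply: measurableT_comp.
Qed.

Import HBNNSimple.

(** A Fubini formula that holds for every product measure, as only measurable
    rectangles are involved. *)
Lemma distribution_fun_etensor_nnsfun f (psi : {nnsfun T2 >-> R}) s :
  measurable_fun [set: T1] f ->
  distribution_fun mu (etensor f (EFin \o psi)) s =
  \sum_(c \in range psi)
    distribution_fun mu1 (fun x => c%:E * f x) s * mu2 (psi @^-1` [set c]).
Proof.
move=> mf.
have mcf c : measurable_fun [set: T1] (fun x => c%:E * f x).
  exact: measurable_funeM.
rewrite /distribution_fun.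
rewrite [X in mu X](_ : _ = \bigcup_(c in range psi)
    ([set x | s%:E < `|c%:E * f x|] `*` (psi @^-1` [set c]))); last first.
  apply/seteqP; split => [[x y] /= sxy|[x y] [_ [y' _ <-]] [/= sx yy']].
    by exists (psi y); [exists y|split => //=; rewrite muleC].
  by rewrite /etensor/= yy' muleC.
rewrite measure_fin_bigcup//.
- by apply: eq_fsbigr => c _; apply: mu12 => //; exact: measurable_abse_gt.
- by move=> c1 c2 _ _ [[x y] [[/= _ <-] [/= _ <-]]].
- by move=> c _; apply: measurableX => //; exact: measurable_abse_gt.
Qed.

(** Values taken by [psi] on a null set only are disregarded, so that just an
    essential bound on [psi] is needed in applications. *)
Lemma tail_bound_etensor_nnsfun f (psi : {nnsfun T2 >-> R}) (C : R) :
  measurable_fun [set: T1] f ->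
  (forall c, (0 <= c)%R -> mu2 (psi @^-1` [set c]) != 0 ->
    tail_bound mu1 (fun x => c%:E * f x) C) ->
  (0 <= C)%R -> tail_bound mu (etensor f (EFin \o psi)) C.
Proof.
move=> mf fC C0 z z0 lz.
have mcf c : measurable_fun [set: T1] (fun x => c%:E * f x).
  exact: measurable_funeM.
have term_ge0 c r : 0 <= distribution_fun mu1 (fun x => c%:E * f x) r *
    mu2 (psi @^-1` [set c]).
  by rewrite mule_ge0// distribution_fun_ge0.
under eq_integral do rewrite distribution_fun_etensor_nnsfun//.
rewrite ge0_integral_fsum//=; last first.
  move=> c; apply: emeasurable_funM => //.
  exact: measurable_distribution_fun.
rewrite distribution_fun_etensor_nnsfun// ge0_mule_fsumr//.
apply: lee_fsum => // c [y _ yc].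
have c0 : (0 <= c)%R by rewrite -yc.
rewrite ge0_integralZr//=.
- have [->|mc] := eqVneq (mu2 (psi @^-1` [set c])) 0; first by rewrite !mule0.
  rewrite muleA lee_wpmul2r// fC//.
  (* As [mu2 {psi = c}] is not zero, finiteness of the sum at [z] forces the
     distribution function of [c f] to be finite there. *)
  have : distribution_fun mu1 (fun x => c%:E * f x) z * mu2 (psi @^-1` [set c]) < +oo.
    apply: le_lt_trans lz; rewrite distribution_fun_etensor_nnsfun//.
    rewrite (fsbigD1 c)//=; last by exists y.
    by rewrite leeDl// fsume_ge0.
  have := distribution_fun_ge0 mu1 (fun x => c%:E * f x) z.
  case: (distribution_fun mu1 _ z) => [a|_|]//.
    by rewrite ltry.
  by rewrite gt0_mulye// lt0e mc /=.
- exact: measurable_distribution_fun.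
Qed.

(** Passage from simple functions to [g], by monotone approximation of [|g|]. *)
Lemma tail_bound_etensor f g (C G : R) :
  measurable_fun [set: T1] f -> measurable_fun [set: T2] g -> (0 <= C)%R ->
  mu2 [set y | G%:E < `|g y|] = 0 ->
  (forall c, (0 <= c <= G)%R -> tail_bound mu1 (fun x => c%:E * f x) C) ->
  tail_bound mu (etensor f g) C.
Proof.
move=> mf mg C0 gG fC.
have mag : measurable_fun [set: T2] (abse \o g) by exact: measurableT_comp.
pose psi := nnsfun_approx measurableT mag.
have cvg_psi y : EFin \o psi^~ y @ \oo --> `|g y|.
  by apply: cvg_nnsfun_approx => //= x _; exact: abse_ge0.
have nd_psi y : {homo (fun n => (psi n y)%:E) : m n / (m <= n)%N >-> m <= n}.
  by move=> m n mn; rewrite lee_fin; exact/lefP/nd_nnsfun_approx.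
have psi_le n y : (psi n y)%:E <= `|g y|.
  by apply: (cvge_to_ge (cvg_psi y)); exists n => // m; exact: nd_psi.
have psiC n : tail_bound mu (etensor f (EFin \o psi n)) C.
  apply: tail_bound_etensor_nnsfun => // c c0 mc; apply: fC; rewrite c0/=.
  rewrite leNgt; apply: contra mc => Gc; rewrite -measure_le0 -gG le_measure ?inE//.
    exact: measurable_abse_gt.
  by move=> y /= yc; apply: lt_le_trans (psi_le n y); rewrite yc lte_fin.
have mpsi n : measurable_fun [set: T1 * T2] (etensor f (EFin \o psi n)).
  apply: measurable_etensor => //.
  by apply/measurable_EFinP.
pose F s n := [set p | s%:E < `|etensor f (EFin \o psi n) p|].
have mF s n : measurable (F s n) by exact: measurable_abse_gt.
have ndF s : nondecreasing_seq (F s).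
  move=> m n mn; apply/subsetPset => -[x y]; rewrite /F /etensor/=.
  move=> /lt_le_trans; apply; rewrite !abseM lee_wpmul2l//.
  by rewrite !gee0_abs ?lee_fin//; exact: nd_psi.
have UF s : (0 <= s)%R -> \bigcup_n F s n = [set p | s%:E < `|etensor f g p|].
  move=> s0; apply/seteqP; split => [[x y] [n _]|[x y]]; rewrite /F/etensor/= !abseM.
    move=> /lt_le_trans; apply; rewrite lee_wpmul2l//.
    by rewrite gee0_abs ?lee_fin.
  move=> sfg.
  (* Otherwise [|f x| * psi n y <= s] for all [n], hence in the limit; the limit
     of the product is not of the form [0 * +oo] because it exceeds [s >= 0]. *)
  suff [n sn] : exists n, s%:E < `|etensor f (EFin \o psi n) (x, y)|.
    by exists n => //=; rewrite -abseM.
  apply: contrapT => /forallNP nF.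
  have fg0 : `|f x| *? `|g y|.
    by apply: neq0_mule_def; rewrite gt_eqF// (le_lt_trans _ sfg)// lee_fin.
  move: sfg; apply/negP; rewrite -leNgt.
  apply: (cvge_to_le (cvgeM fg0 (cvg_cst _) (cvg_psi y))).
  apply: nearW => n /=; rewrite leNgt; apply/negP => sn; apply: (nF n).
  by rewrite /etensor/= abseM [X in _ * X]gee0_abs ?lee_fin//.
have cvg_dist s : (0 <= s)%R ->
    distribution_fun mu (etensor f (EFin \o psi n)) s @[n --> \oo] -->
    distribution_fun mu (etensor f g) s.
  move=> s0; rewrite /distribution_fun -UF//.
  exact: (nondecreasing_cvg_mu (mF s) (bigcupT_measurable _ (mF s)) (ndF s)).
have nd_dist s : {homo (fun n => distribution_fun mu (etensor f (EFin \o psi n)) s) :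
    m n / (m <= n)%N >-> m <= n}.
  by move=> m n mn; apply: le_measure; rewrite ?inE;
    [exact: mF..|exact/subsetPset/ndF].
have dist_le s n : (0 <= s)%R -> distribution_fun mu (etensor f (EFin \o psi n)) s <=
   distribution_fun mu (etensor f g) s.
  by move=> s0; apply: (cvge_to_ge (cvg_dist s s0)); exists n => // m; exact: nd_dist.
move=> z z0 lz.
have -> : \int[@lebesgue_measure R]_(r in `]z, +oo[)
      distribution_fun mu (etensor f g) r =
    \int[@lebesgue_measure R]_(r in `]z, +oo[)
      limn (fun n => distribution_fun mu (etensor f (EFin \o psi n)) r).
  apply: eq_integral => r; rewrite inE/= in_itv/= andbT => zr.
  by rewrite (cvg_lim _ (cvg_dist r (le_trans z0 (ltW zr)))).
have mcv := @cvg_monotone_convergence _ _ _ (@lebesgue_measure R) `]z, +oo[%classic _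
  (fun n r => distribution_fun mu (etensor f (EFin \o psi n)) r).
apply: (cvge_to_le (mcv _ _ _ _)) => //.
- by move=> n; exact: measurable_distribution_fun.
- apply: nearW => n; apply: le_trans (psiC n z z0 _) _.
    by apply: le_lt_trans lz; exact: dist_le.
  by rewrite lee_wpmul2l ?lee_fin// dist_le.
Qed.

Lemma Lnormoo_null g :
  measurable_fun [set: T2] g -> 'N[mu2]_+oo[g] < +oo ->
  mu2 [set y | (fine 'N[mu2]_+oo[g])%:E < `|g y|] = 0.
Proof.
move=> mg gy.
have gfin : 'N[mu2]_+oo[g] \is a fin_num by rewrite ge0_fin_numE ?Lnorm_ge0.
have mG := measurable_abse_gt (fine 'N[mu2]_+oo[g]) mg.
(* On a null space the norm is [0] by convention, not the essential supremum. *)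
have [T0|T0] := ltP 0 (mu2 [set: T2]); last first.
  apply/eqP; rewrite -measure_le0; apply: le_trans T0.
  by apply: le_measure; rewrite ?inE.
apply: measure_negligible => //; rewrite fineK// unlock T0.
apply: negligibleS (ess_sup_ge mu2 (abse \o g)) => y /= gy'.
by apply/negP; rewrite -ltNge.
Qed.

Lemma Lnormoo_fin_num_ae g :
  measurable_fun [set: T2] g -> 'N[mu2]_+oo[g] < +oo ->
  {ae mu2, forall y, g y \is a fin_num}.
Proof.
move=> mg gy; apply: negligibleS (_ : mu2.-negligible
    [set y | (fine 'N[mu2]_+oo[g])%:E < `|g y|]); last first.
  by apply/negligibleP; [exact: measurable_abse_gt|exact: Lnormoo_null].
move=> y /= /negP; rewrite fin_num_abs -leNgt leye_eq => /eqP ->.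
exact: ltry.
Qed.

Lemma Linfinf_norm_etensor_le f g :
  measurable_fun [set: T1] f -> measurable_fun [set: T2] g ->
  Linfinf_norm mu1 f < +oo -> 'N[mu2]_+oo[g] < +oo ->
  Linfinf_norm mu (etensor f g) <= Linfinf_norm mu1 f * 'N[mu2]_+oo[g].
Proof.
move=> mf mg fy gy.
have f0 := Linfinf_norm_ge0 mu1 mf.
have g0 := Lnorm_ge0 mu2 +oo g.
have ffin : Linfinf_norm mu1 f \is a fin_num by rewrite ge0_fin_numE.
have gfin : 'N[mu2]_+oo[g] \is a fin_num by rewrite ge0_fin_numE.
have gG := Lnormoo_null mg gy.
rewrite -(fineK ffin) -(fineK gfin) -EFinM.
set C := fine (Linfinf_norm mu1 f); set G := fine _ in gG *.
have C0 : (0 <= C)%R by exact: fine_ge0.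
have G0 : (0 <= G)%R by exact: fine_ge0.
apply: tail_bound_Linfinf_norm_le; [exact: measurable_etensor|exact: mulr_ge0|].
apply: (tail_bound_etensor mf mg _ gG); first exact: mulr_ge0.
move=> c /andP[c0 cG]; apply: Linfinf_norm_le_tail_bound.
  exact: measurable_funeM.
apply: (@le_trans _ _ (c * C)%:E); first by apply: Linfinf_normZ => //; rewrite fineK.
by rewrite lee_fin mulrC ler_wpM2l.
Qed.

Lemma etensor_fin_num_ae f g :
  {ae mu1, forall x, f x \is a fin_num} ->
  {ae mu2, forall y, g y \is a fin_num} ->
  {ae mu, forall p, etensor f g p \is a fin_num}.
Proof.
move=> [A [mA A0 fA]] [B [mB B0 gB]].
exists ((A `*` setT) `|` (setT `*` B)); split.
- by apply: measurableU; apply: measurableX.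
- apply/eqP; rewrite measureU0//; [|exact: measurableX..|].
    by rewrite mu12// A0 mul0e.
  by rewrite mu12// B0 mule0.
- move=> [x y] /= fgxy; apply: contrapT => /not_orP[/= xA yB]; apply: fgxy.
  apply: fin_numM; apply: contrapT => fin.
    by apply: xA; split => //; apply: fA.
  by apply: yB; split => //; apply: gB.
Qed.

End tensor.

(** * Complex-valued functions *)

Section complex_valued.
Context {d} {T : measurableType d} {R : realType}.
Implicit Types h : T -> R[i].

Lemma measurable_cmodulus h : cmeasurable h ->
  measurable_fun [set: T] (cmodulus h).
Proof.
move=> [mre mim]; apply/measurable_EFinP.
have -> : (fun x => Normc.normc (h x)) = Num.sqrt \o
    (fun x => complex.Re (h x) ^+ 2 + complex.Im (h x) ^+ 2)%R.
  by apply/funext => x /=; case: (h x).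
apply: measurableT_comp.
  by apply: continuous_measurable_fun; exact: sqrt_continuous.
by apply: measurable_funD; exact: measurable_funX.
Qed.

End complex_valued.

Lemma cmeasurable_ctensor {d1 d2} {T1 : measurableType d1}
    {T2 : measurableType d2} {R : realType} (f : T1 -> R[i]) (g : T2 -> R[i]) :
  cmeasurable f -> cmeasurable g -> cmeasurable (ctensor f g).
Proof.
move=> [mfr mfi] [mgr mgi].
have m1 (u : T1 -> R) : measurable_fun [set: T1] u ->
    measurable_fun [set: T1 * T2] (fun p => u p.1).
  by move=> mu; apply: (measurableT_comp mu); exact: measurable_fst.
have m2 (u : T2 -> R) : measurable_fun [set: T2] u ->
    measurable_fun [set: T1 * T2] (fun p => u p.2).
  by move=> mu; apply: (measurableT_comp mu); exact: measurable_snd.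
split.
  rewrite (_ : (fun _ => _) = (fun p => complex.Re (f p.1) * complex.Re (g p.2) -
     complex.Im (f p.1) * complex.Im (g p.2))%R).
    by apply: measurable_funB; apply: measurable_funM;
      [exact: m1 mfr|exact: m2 mgr|exact: m1 mfi|exact: m2 mgi].
  by apply/funext => -[x y] /=; rewrite /ctensor/=; case: (f x); case: (g y).
rewrite (_ : (fun _ => _) = (fun p => complex.Re (f p.1) * complex.Im (g p.2) +
     complex.Im (f p.1) * complex.Re (g p.2))%R).
  by apply: measurable_funD; apply: measurable_funM;
      [exact: m1 mfr|exact: m2 mgi|exact: m1 mfi|exact: m2 mgr].
by apply/funext => -[x y] /=; rewrite /ctensor/=; case: (f x); case: (g y).
Qed.

Lemma cmodulus_ctensor d1 d2 (T1 : measurableType d1)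
    (T2 : measurableType d2) (R : realType) (f : T1 -> R[i]) (g : T2 -> R[i]) :
  cmodulus (ctensor f g) = etensor (cmodulus f) (cmodulus g).
Proof.
by apply/funext => -[x y]; rewrite /cmodulus/ctensor/etensor/= Normc.normcM EFinM.
Qed.

Theorem theorem6 (R : realType) (d1 d2 : measure_display)
    (T1 : measurableType d1) (T2 : measurableType d2)
    (mu1 : {measure set T1 -> \bar R}) (mu2 : {measure set T2 -> \bar R})
    (mu : {measure set (T1 * T2) -> \bar R})
    (hmu : is_product_measure mu1 mu2 mu) :
  (forall (f : T1 -> \bar R) (g : T2 -> \bar R),
     in_Linfinf mu1 f -> in_Linf mu2 g ->
     in_Linfinf mu (etensor f g) /\
     Linfinf_norm mu (etensor f g) <= Linfinf_norm mu1 f * 'N[mu2]_+oo[g]) /\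
  (forall (f : T1 -> R[i]) (g : T2 -> R[i]),
     in_cLinfinf mu1 f -> in_cLinf mu2 g ->
     in_cLinfinf mu (ctensor f g) /\
     Linfinf_norm mu (cmodulus (ctensor f g)) <=
       Linfinf_norm mu1 (cmodulus f) * 'N[mu2]_+oo[cmodulus g]).
Proof.
split=> f g.
  move=> [mf ffin fy] [mg gy].
  have fg_le := Linfinf_norm_etensor_le hmu mf mg fy gy.
  split=> //; split; first exact: measurable_etensor.
    exact: (etensor_fin_num_ae hmu ffin (Lnormoo_fin_num_ae mg gy)).
  apply: le_lt_trans fg_le _.
  by apply: lte_mul_pinfty => //; rewrite ?ge0_fin_numE// Linfinf_norm_ge0.
move=> [mf fy] [mg gy]; rewrite /in_cLinfinf cmodulus_ctensor.
have mcf := measurable_cmodulus mf.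
have fg_le := Linfinf_norm_etensor_le hmu mcf (measurable_cmodulus mg) fy gy.
split=> //; split; first exact: cmeasurable_ctensor.
apply: le_lt_trans fg_le _.
by apply: lte_mul_pinfty => //; rewrite ?ge0_fin_numE// Linfinf_norm_ge0.
Qed.
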